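(* For $n\in\mathbb{Z}_{\ge1}$ let $N=(n,n)$ and $M_n=\langle N,\,N+(1,3),\,N+(2,1),\,N+(2,4)\rangle\subset\mathbb{Z}_{\ge0}^2$. For an integer $k$ and integers $0\le i\le k$ let $$A=(48k+18,\;48k+28),\qquad B=(18k^2+27k+4,\;18k^2+27k+4),$$ $$R_i=(36k^2-18ik+24k-9i+3,\;36k^2-18ik+36k-21i+5).$$ If $n=6k+1$ with $k\ge5$, then $\operatorname{Betti}(M_n)\supseteq\{A,B,R_0,\dots,R_k\}$. In particular, $|\operatorname{Betti}(M_n)|$ is unbounded for $n$ large.
   Context: For $v_1,\dots,v_k\in\mathbb{Z}_{\ge0}^d$, $\langle v_1,\dots,v_k\rangle$ is the affine semigroup $M$ of all $\mathbb{Z}_{\ge0}$-linear combinations of $v_1,\dots,v_k$, and its factorization homomorphism is $\pi:\mathbb{Z}_{\ge0}^k\to M$, $\pi(z)=z_1v_1+\cdots+z_kv_k$. The kernel congruence is $\ker\pi=\{(z,z'):\pi(z)=\pi(z')\}$. A congruence on $\mathbb{Z}_{\ge0}^k$ is an equivalence relation closed under translation (if $(z,z')$ is in it, so is $(z+u,z'+u)$ for all $u\in\mathbb{Z}_{\ge0}^k$). A presentation of $M$ is a subset $\rho\subset\ker\pi$ such that $\ker\pi$ is the smallest congruence on $\mathbb{Z}_{\ge0}^k$ containing $\rho$; it is minimal if no proper subset of $\rho$ is a presentation of $M$. The set of Betti elements is $\operatorname{Betti}(M)=\{\pi(z):(z,z')\in\rho\}$ for any minimal presentation $\rho$ of $M$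 (this set is known not to depend on $\rho$). Equivalently (known fact), $v\in\operatorname{Betti}(M)$ if and only if the graph $\nabla_v$ is disconnected, where $\nabla_v$ has vertex set $\pi^{-1}(v)$ and two vertices $z,z'$ are joined by an edge whenever $z_i>0$ and $z_i'>0$ for some $i$. *)

(* Defs.v *)
From mathcomp Require Import all_boot all_order all_algebra.
From mathcomp Require Import boolp classical_sets functions cardinality.
From mathcomp Require Import zify.

Set Implicit Arguments.
Unset Strict Implicit.
Unset Printing Implicit Defensive.

Import GRing.Theory.

Local Open Scope classical_set_scope.
Local Open Scope ring_scope.

(* An affine semigroup <v_1, ..., v_k> in N^d is given by the tuple of its
   generators; z : 'rV[nat]_k is the factorization z_1 v_1 + ... + z_k v_k. *)
Definition fact_hom (d k : nat) (v : k.-tuple 'rV[nat]_d) (z : 'rV[nat]_k) :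
    'rV[nat]_d :=
  \sum_(i < k) tnth v i *+ z 0 i.

Definition ker_cong (d k : nat) (v : k.-tuple 'rV[nat]_d) :
    set ('rV[nat]_k * 'rV[nat]_k) :=
  [set p | fact_hom v p.1 = fact_hom v p.2].

Definition congruence (k : nat) (E : set ('rV[nat]_k * 'rV[nat]_k)) : Prop :=
  [/\ forall z, E (z, z),
      forall z z', E (z, z') -> E (z', z),
      forall z z' z'', E (z, z') -> E (z', z'') -> E (z, z'')
    & forall z z' (u : 'rV[nat]_k), E (z, z') -> E (z + u, z' + u)].

Definition presentation (d k : nat) (v : k.-tuple 'rV[nat]_d)
    (rho : set ('rV[nat]_k * 'rV[nat]_k)) : Prop :=
  rho `<=` ker_cong v /\ ker_cong v = smallest (@congruence k) rho.

Definition minimal_presentation (d k : nat) (v : k.-tuple 'rV[nat]_d)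
    (rho : set ('rV[nat]_k * 'rV[nat]_k)) : Prop :=
  presentation v rho /\ forall rho', rho' `<` rho -> ~ presentation v rho'.

(* The set {pi(z) : (z, z') \in rho} is the same for every minimal presentation
   rho; the union over all of them is that common value. *)
Definition Betti (d k : nat) (v : k.-tuple 'rV[nat]_d) : set 'rV[nat]_d :=
  \bigcup_(rho in [set rho | minimal_presentation v rho])
    [set fact_hom v p.1 | p in rho].

Definition pt (a b : nat) : 'rV[nat]_2 := \row_(j < 2) tnth [tuple a; b] j.

Definition gens (n : nat) : 4.-tuple 'rV[nat]_2 :=
  let N := pt n n in [tuple N; N + pt 1 3; N + pt 2 1; N + pt 2 4].

Definition bettiA (k : nat) : 'rV[nat]_2 := pt (48 * k + 18) (48 * k + 28).

Definition bettiB (k : nat) : 'rV[nat]_2 :=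
  pt (18 * k ^ 2 + 27 * k + 4) (18 * k ^ 2 + 27 * k + 4).

(* The subtractions are on nat; bettiR_int shows that they do not truncate
   when i <= k. *)
Definition bettiR (k i : nat) : 'rV[nat]_2 :=
  pt (36 * k ^ 2 + 24 * k + 3 - (18 * i * k + 9 * i))
     (36 * k ^ 2 + 36 * k + 5 - (18 * i * k + 21 * i)).

Lemma bettiR_int (k i : nat) : (i <= k)%N ->
  (bettiR k i 0 0)%:Z =
    36 * k%:Z ^+ 2 - 18 * i%:Z * k%:Z + 24 * k%:Z - 9 * i%:Z + 3 /\
  (bettiR k i 0 1)%:Z =
    36 * k%:Z ^+ 2 - 18 * i%:Z * k%:Z + 36 * k%:Z - 21 * i%:Z + 5.
Proof.
move=> ik; have ikk : (i * k <= k * k)%N by rewrite leq_mul2r ik orbT.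
by rewrite /bettiR /pt !mxE !(tnth_nth 0%N) /= -!mulnn expr2; split; nia.
Qed.

(* Main.v *)
Require Import Defs.
From mathcomp Require Import all_boot all_order all_algebra.
From mathcomp Require Import boolp classical_sets functions cardinality.
From mathcomp Require Import zify.

(** An element of the semigroup is a Betti element as soon as its fibre graph
    is disconnected.  Since [Betti] is defined through minimal presentations,
    one has to be exhibited: in each fibre choose one representative per
    connected component and join all of them to one distinguished component by
    a star ([star]).  When the generators are nonzero, every relation follows
    from the stars, by induction on the size of the element: two adjacent
    factorizations share a generator, which can be cancelled
    ([star_generates]).  No edge of a star can be dropped, because a nontrivial
    translate of a relation never leaves a connected component, so that a
    component cut off from its star stays cut off ([star_minimal]).

    For the elements [A], [B] and [R_i] the fibre is disconnected for a strong
    reason: the generators split into two classes such that each factorization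
    uses generators of a single class, and both classes occur
    ([Betti_split_support]).  To see this, write a factorization as (a, b, c, e)
    with s = a + b + c + e and r = b + 2c + 2e.  The first coordinate of the
    element is n s + r, and the difference y - x of the coordinates is
    2(b + e) - c.  The latter expresses c through b + e, so that both s and r
    grow with b + e; comparing n s + r with the division of the first coordinate
    by n leaves only q = 0 or q = 1 for the number q of copies of n carried from
    s to r ([carry]).  The value q = 0 gives one class of generators and q = 1
    the other one; for [A] only q = 0 survives, and b + e = 5 or 6 separates the
    classes.

    The points R_0, ..., R_k are pairwise distinct, hence the number of Betti
    elements is unbounded. *)

Set Implicit Arguments.
Unset Strict Implicit.
Unset Printing Implicit Defensive.

Local Open Scope classical_set_scope.

(** * A minimal presentation made of stars *)

Section DisconnectedFibres.
Local Open Scope ring_scope.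
Import GRing.Theory.
Context {d k : nat} (v : k.-tuple 'rV[nat]_d).
Implicit Types z w u : 'rV[nat]_k.

Lemma fact_homD z u : fact_hom v (z + u) = fact_hom v z + fact_hom v u.
Proof.
by rewrite /fact_hom -big_split; apply: eq_bigr => i _; rewrite mxE mulrnDr.
Qed.

Lemma fact_hom_delta i : fact_hom v (delta_mx 0 i) = tnth v i.
Proof.
rewrite /fact_hom (bigD1 i) //= big1 => [|j ji].
  by rewrite mxE !eqxx addr0.
by rewrite mxE eqxx (negbTE ji).
Qed.

Lemma row_nat_addI (m : nat) (x y t : 'rV[nat]_m) : x + t = y + t -> x = y.
Proof.
move=> /rowP e; apply/rowP => j; have := e j; rewrite !mxE.
by move/addIn.
Qed.

Lemma split_delta z (i : 'I_k) :
  (0 < z 0%R i)%N -> exists w, z = w + delta_mx 0 i.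
Proof.
move=> zi; exists (\row_j (z 0%R j - (j == i))%N); apply/rowP => j.
rewrite !mxE.
case: (eqVneq j i) => [->|_] /=; first by rewrite [RHS](subnK zi).
by rewrite subn0 [RHS]addn0.
Qed.

Definition adj z z' :=
  fact_hom v z = fact_hom v z' /\
  exists i, (0 < z 0%R i)%N /\ (0 < z' 0%R i)%N.

(** Being in the same connected component of a fibre graph, stated as not being
    separated by any union of components: to refute it, it is enough to name
    one such union. *)
Definition conn z z' :=
  fact_hom v z = fact_hom v z' /\
  forall P : set 'rV[nat]_k,
    (forall a b, adj a b -> P a <-> P b) -> P z <-> P z'.

Lemma conn_refl z : conn z z. Proof. by split. Qed.

Lemma conn_sym z z' : conn z z' -> conn z' z.
Proof. by case=> e h; split=> // P hP; split=> /(h P hP). Qed.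

Lemma conn_trans z z' z'' : conn z z' -> conn z' z'' -> conn z z''.
Proof.
move=> [e h] [e' h']; split=> [|P hP]; first by rewrite e.
exact: iff_trans (h P hP) (h' P hP).
Qed.

(** The two translates share the support of [u]. *)
Lemma conn_translate z z' u :
  fact_hom v z = fact_hom v z' -> u != 0 -> conn (z + u) (z' + u).
Proof.
move=> e u0; have e' : fact_hom v (z + u) = fact_hom v (z' + u).
  by rewrite !fact_homD e.
split=> // P; apply; split=> //.
have [i ui] : exists i, u 0 i != 0.
  apply: contrapT => h; move/eqP: u0; apply; apply/rowP => i; rewrite mxE.
  by apply: contrapT => ui; apply: h; exists i; apply/eqP.
by exists i; rewrite !mxE -lt0n in ui *; split; apply: ltn_addl.
Qed.

Definition rep z := xget 0 (conn z).

Lemma conn_rep z : conn z (rep z).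
Proof. by apply: (@xgetPex _ 0 (conn z)); exists z; exact: conn_refl. Qed.

Lemma rep_conn z z' : conn z z' -> rep z = rep z'.
Proof.
move=> h; rewrite /rep; congr xget; apply/seteqP; split=> w hw.
  exact: conn_trans (conn_sym h) hw.
exact: conn_trans h hw.
Qed.

Lemma rep_idem z : rep (rep z) = rep z.
Proof. by rewrite -(rep_conn (conn_rep z)). Qed.

Lemma fact_hom_rep z : fact_hom v (rep z) = fact_hom v z.
Proof. by case: (conn_rep z). Qed.

(** The centre of the star of the fibre of [z]. *)
Definition root z := rep (xget 0 [set w | fact_hom v w = fact_hom v z]).

Lemma fact_hom_root z : fact_hom v (root z) = fact_hom v z.
Proof.
rewrite fact_hom_rep.
by apply: (@xgetPex _ 0 [set w | fact_hom v w = fact_hom v z]); exists z.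
Qed.

Lemma root_fact_hom z z' : fact_hom v z = fact_hom v z' -> root z = root z'.
Proof. by rewrite /root => ->. Qed.

Definition star : set ('rV[nat]_k * 'rV[nat]_k) :=
  [set (root z, rep z) | z in [set z | rep z <> root z]].

Lemma congruence_ker : congruence (ker_cong v).
Proof.
split=> [//|z z'|z z' z''|z z' u]; rewrite /ker_cong /=; try by move=> ->.
by rewrite !fact_homD => ->.
Qed.

Lemma star_sub_ker : star `<=` ker_cong v.
Proof.
by move=> _ [z _ <-]; rewrite /ker_cong /= fact_hom_root fact_hom_rep.
Qed.

(** Induction on the sum of the coordinates of the common image.  Adjacent
    factorizations become related after cancelling a shared generator, whose
    nonzero weight makes the image smaller; hence each component lies in one
    class, and the star glues the components of a fibre together. *)
Lemma star_generates (E : set ('rV[nat]_k * 'rV[nat]_k)) :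
  (forall i, tnth v i != 0) ->
  congruence E -> star `<=` E -> ker_cong v `<=` E.
Proof.
move=> v0 [Er Es Et Ea] sE [z z']; rewrite /ker_cong /=.
pose wt (x : 'rV[nat]_d) := (\sum_j x 0%R j)%N.
have wtD x y : wt (x + y) = (wt x + wt y)%N.
  by rewrite /wt -big_split; apply: eq_bigr => j _; rewrite mxE.
have wt_gt0 i : (0 < wt (tnth v i))%N.
  rewrite lt0n; apply: contra (v0 i); rewrite sum_nat_eq0 => /forallP h.
  by apply/eqP/rowP => j; rewrite mxE; apply/eqP; exact: h.
have [m] := ubnP (wt (fact_hom v z)).
elim: m => // m IH in z z' * => le_m e.
have Eadj a b : fact_hom v a = fact_hom v z -> adj a b -> E (a, b).
  move=> az [ab [i [/split_delta[a' a'E] /split_delta[b' b'E]]]].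
  move: az ab; rewrite {}a'E {}b'E !fact_homD fact_hom_delta => az.
  move=> /row_nat_addI ab; apply/Ea/IH => //.
  move: le_m; rewrite -az wtD; have := wt_gt0 i; lia.
have Econn a b : fact_hom v a = fact_hom v z -> conn a b -> E (a, b).
  move=> az [_ h].
  case: (h [set c | fact_hom v c = fact_hom v z /\ E (a, c)]); last first.
    by move=> /(_ (conj az (Er a)))[].
  move=> c c' adjcc'; have [cc' _] := adjcc'; split=> -[cz Eac].
    by split; [rewrite -cc'|exact: Et Eac (Eadj _ _ cz adjcc')].
  rewrite -cc' in cz; split=> //.
  exact: Et Eac (Es _ _ (Eadj _ _ cz adjcc')).
have Eroot a : fact_hom v a = fact_hom v z -> E (root z, a).
  move=> az; apply: Et (Es _ _ (Econn _ _ az (conn_rep a))).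
  rewrite -(root_fact_hom az); have [->|ne] := pselect (rep a = root a).
    exact: Er.
  by apply: sE; exists a.
exact: Et (Es _ _ (Eroot _ erefl)) (Eroot _ (esym e)).
Qed.

(** If the edge from [root z] to [rep z] is missing from [rho], the relation
    saying that both members have the same image and that both or none lie in
    the component of [z] is a congruence, by [conn_translate].  It contains
    [rho] but not the missing edge. *)
Lemma star_minimal (rho : set ('rV[nat]_k * 'rV[nat]_k)) :
  rho `<` star -> ~ presentation v rho.
Proof.
move=> [rs /existsNP[_ /not_implyP[[z nz <-] nrho]]] [_ gen].
pose E := [set p | fact_hom v p.1 = fact_hom v p.2 /\
                   (rep p.1 = rep z <-> rep p.2 = rep z)].
have: ker_cong v (root z, rep z).
  by rewrite /ker_cong /= fact_hom_root fact_hom_rep.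
rewrite gen => /(_ E); case.
- split; last first.
    move=> p /[dup] rhop /rs[a na ap]; rewrite -ap in rhop *.
    split=> /=; first by rewrite fact_hom_root fact_hom_rep.
    have rr b : rep (root b) = root b by rewrite rep_idem.
    (* An edge with exactly one end in the component of [z] either has its
       centre there, against the choice of [z], or is the missing edge. *)
    rewrite rep_idem rr; split=> h; exfalso.
      apply: nz; rewrite -h; apply: root_fact_hom.
      by rewrite -fact_hom_root h fact_hom_rep.
    apply: nrho; rewrite -h (_ : root z = root a) //; apply: root_fact_hom.
    by rewrite -[LHS]fact_hom_rep -h fact_hom_rep.
  split=> [a|a b|a b c|a b u].
  + by split.
  + by move=> [/= ab [h h']]; split.
  + move=> [/= ab h] [/= bc h'].
    by split; [exact: etrans ab bc|exact: iff_trans h h'].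
  + move=> [/= ab h]; have [->|u0] := eqVneq u 0; first by rewrite !addr0.
    split=> /=; first by rewrite !fact_homD ab.
    by rewrite (rep_conn (conn_translate ab u0)).
- move=> _ [_ /(_ (rep_idem z))]; rewrite rep_idem => h.
  exact: nz.
Qed.

Lemma star_minimal_presentation :
  (forall i, tnth v i != 0) -> minimal_presentation v star.
Proof.
move=> v0; split; last exact: star_minimal.
split; first exact: star_sub_ker.
apply/seteqP; split.
  by move=> p kp E [cE sE]; exact: star_generates v0 cE sE p kp.
by move=> p; apply; split; [exact: congruence_ker|exact: star_sub_ker].
Qed.

(** At least one of two distinct components is not the central one, and then
    it is the end of an edge of the star. *)
Lemma Betti_not_conn z z' : (forall i, tnth v i != 0) ->
  fact_hom v z = fact_hom v z' -> ~ conn z z' -> Betti v (fact_hom v z).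
Proof.
move=> v0 e nc; exists star; first exact: star_minimal_presentation.
have aux a : fact_hom v a = fact_hom v z -> rep a <> root a ->
    [set fact_hom v p.1 | p in star] (fact_hom v z).
  by move=> az na; exists (root a, rep a); [exists a|rewrite /= fact_hom_root].
have [ez|/aux] := pselect (rep z = root z); last exact.
have [ez'|/aux] := pselect (rep z' = root z'); last exact.
case: nc; apply: conn_trans (conn_rep z) _.
by rewrite ez (root_fact_hom e) -ez'; apply/conn_sym/conn_rep.
Qed.

(** The factorizations supported in [I] form a union of components. *)
Lemma Betti_split_support (I : pred 'I_k) z z' : (forall i, tnth v i != 0) ->
  fact_hom v z = fact_hom v z' ->
  (forall i, ~~ I i -> z 0 i = 0%N) -> (exists2 i, ~~ I i & z' 0 i <> 0%N) ->
  (forall w, fact_hom v w = fact_hom v z ->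
     (forall i, ~~ I i -> w 0 i = 0%N) \/ (forall i, I i -> w 0 i = 0%N)) ->
  Betti v (fact_hom v z).
Proof.
move=> v0 e zI [i0 ni0 z'i0] fib; apply: Betti_not_conn v0 e _ => -[_].
pose P w := fact_hom v w = fact_hom v z /\ forall i, ~~ I i -> w 0 i = 0%N.
case/(_ P) => [a b [ab [i [ai bi]]]|/(_ (conj erefl zI))[_ h] _]; last first.
  by case: z'i0; exact: h.
split=> -[h hI].
  have h' : fact_hom v b = fact_hom v z by rewrite -ab.
  split=> //; case: (fib b h') => // bI; exfalso.
  by have [/bI|/hI] := boolP (I i); lia.
have h' : fact_hom v a = fact_hom v z by rewrite ab.
split=> //; case: (fib a h') => // aI; exfalso.
by have [/aI|/hI] := boolP (I i); lia.
Qed.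

End DisconnectedFibres.

(** * Factorizations over the generators of M_n *)

Section Gens.
Local Open Scope ring_scope.
Import GRing.Theory.

Definition fact4 (a b c e : nat) : 'rV[nat]_4 :=
  \row_(j < 4) tnth [tuple a; b; c; e] j.

Lemma fact4_surj (z : 'rV[nat]_4) : exists a b c e, z = fact4 a b c e.
Proof.
exists (z 0 (inord 0)), (z 0 (inord 1)), (z 0 (inord 2)), (z 0 (inord 3)).
apply/rowP => j; rewrite mxE (tnth_nth 0%N).
case: j => [[|[|[|[|]]]] lj] //=; congr (z 0 _); apply/val_inj;
  by rewrite /= inordK.
Qed.

Lemma pt_inj x y x' y' : pt x y = pt x' y' -> x = x' /\ y = y'.
Proof.
move=> /rowP e; split; [have := e 0|have := e 1];
  by rewrite !mxE !(tnth_nth 0%N).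
Qed.

Lemma ptMn x y m : pt x y *+ m = pt (x * m) (y * m).
Proof.
apply/rowP => j; rewrite mulmxnE !mxE !(tnth_nth 0%N) /=.
case: j => [[|[|]] lj] //=; lia.
Qed.

Lemma ptD x y x' y' : pt x y + pt x' y' = pt (x + x') (y + y').
Proof.
by apply/rowP => -[[|[|]] lj] //; rewrite !mxE !(tnth_nth 0%N).
Qed.

Lemma fact_hom_gens n a b c e : fact_hom (gens n) (fact4 a b c e) =
  pt (n * (a + b + c + e) + (b + 2 * c + 2 * e))
     (n * (a + b + c + e) + (3 * b + c + 4 * e)).
Proof.
rewrite /fact_hom !big_ord_recl big_ord0 !mxE !(tnth_nth 0) /=.
rewrite !ptD !ptMn !addr0 !ptD; congr pt; lia.
Qed.

Lemma gens_neq0 n : (0 < n)%N -> forall i, tnth (gens n) i != 0.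
Proof.
move=> n0 i; apply/eqP => /rowP /(_ 0); rewrite (tnth_nth 0).
by case: i => [[|[|[|[|]]]] li] //=; rewrite !mxE ?(tnth_nth 0%N) /=; lia.
Qed.

Lemma Betti_gens n (I : pred 'I_4) x y (z z' : 'rV[nat]_4) : (0 < n)%N ->
  fact_hom (gens n) z = pt x y -> fact_hom (gens n) z' = pt x y ->
  (forall i, ~~ I i -> z 0 i = 0%N) -> (exists2 i, ~~ I i & z' 0 i <> 0%N) ->
  (forall a b c e,
    (n * (a + b + c + e) + (b + 2 * c + 2 * e))%N = x ->
    (n * (a + b + c + e) + (3 * b + c + 4 * e))%N = y ->
    (forall i, ~~ I i -> fact4 a b c e 0 i = 0%N) \/
    (forall i, I i -> fact4 a b c e 0 i = 0%N)) ->
  Betti (gens n) (pt x y).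
Proof.
move=> n0 zE z'E zI z'I fib; rewrite -zE.
apply: (@Betti_split_support _ _ _ I z z') => //; first exact: gens_neq0.
  by rewrite zE z'E.
move=> w; have [a [b [c [e ->]]]] := fact4_surj w.
by rewrite zE fact_hom_gens => /pt_inj[]; exact: fib.
Qed.

End Gens.

(** * The fibres of A, B and R_i *)

Section Fibres.
Local Open Scope nat_scope.

(** Two expansions of one number in base [n], the left one with a possibly
    oversized last digit [r], differ by carries of [n] only. *)
Lemma carry n s r S r' : n * s + r = n * S + r' -> r' < n + r ->
  exists2 q, s + q = S & r = r' + n * q.
Proof.
move=> e lt; have [le|gt] := leqP s S.
  exists (S - s); first exact: subnKC.
  by move: e; rewrite -{1}(subnKC le) mulnDr; lia.
by have := leq_mul (leqnn n) gt; rewrite mulnS; lia.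
Qed.

(** Here y - x = 10, so c = 2(b + e) - 10 and a + b + c + e >= 3(b + e) - 10,
    whereas the carry-free height is 8.  A carry would need
    b + 2c + 2e >= n + 10, hence b + e > 10 and a height above 20.  Without
    carry, b + e is 5 or 6. *)
Lemma fibre_A k a b c e : 5 <= k ->
  (6 * k + 1) * (a + b + c + e) + (b + 2 * c + 2 * e) = 48 * k + 18 ->
  (6 * k + 1) * (a + b + c + e) + (3 * b + c + 4 * e) = 48 * k + 28 ->
  (b = 0 /\ c = 0) \/ (a = 0 /\ e = 0).
Proof.
move=> k5 ex ey.
have [||[|q] es er] :=
  @carry (6 * k + 1) (a + b + c + e) (b + 2 * c + 2 * e) 8 10; lia.
Qed.

(** Both coordinates are n(3k + 4), and c = 2(b + e).  Without carry only the
    first generator is used.  A carry makes b + e <= k + 1, so that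
    b + 2c + 2e <= 6(b + e) < 2n allows a single one, and then
    6(b + e) >= n = 6k + 1 forces b + e = k + 1, which exhausts the height. *)
Lemma fibre_B k a b c e :
  (6 * k + 1) * (a + b + c + e) + (b + 2 * c + 2 * e) =
    18 * k ^ 2 + 27 * k + 4 ->
  (6 * k + 1) * (a + b + c + e) + (3 * b + c + 4 * e) =
    18 * k ^ 2 + 27 * k + 4 ->
  a = 0 \/ [/\ b = 0, c = 0 & e = 0].
Proof.
move=> ex ey; have ec : c = 2 * (b + e) by lia.
have [||[|[|q]] es er] :=
  @carry (6 * k + 1) (a + b + c + e) (b + 2 * c + 2 * e) (3 * k + 4) 0;
  try lia.
by right; split; lia.
Qed.

(** With b + e = 6j + 1 + r one gets c = 2r, and q carries leave
    a = 3i + 1 - 3r - q and qn = b + 2e + 4r - (6j + 1) <= 6j + 1 + 6r.  Hence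
    r <= i and qn <= n.  If q = 0, then r = e = 0; if q = 1, the equality cases
    r = i and b = 0 hold, and a = 0. *)
Lemma fibre_R i j a b c e : let k := i + j in
  (6 * k + 1) * (a + b + c + e) + (b + 2 * c + 2 * e) =
    (6 * k + 1) * (3 * k + 3 * j + 2) + (6 * j + 1) ->
  (6 * k + 1) * (a + b + c + e) + (3 * b + c + 4 * e) =
    (6 * k + 1) * (3 * k + 3 * j + 2) + (18 * j + 3) ->
  (c = 0 /\ e = 0) \/ (a = 0 /\ b = 0).
Proof.
rewrite /= => ex ey; have ec : c + 12 * j + 2 = 2 * (b + e) by lia.
have [|[|[|q]] es er] := carry ex; lia.
Qed.

Lemma forall_ord4 (P : 'I_4 -> Prop) :
  P (inord 0) -> P (inord 1) -> P (inord 2) -> P (inord 3) -> forall i, P i.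
Proof.
move=> p0 p1 p2 p3 i; rewrite -[i]inord_val.
by case: i => [[|[|[|[|]]]] li].
Qed.

Lemma fact4E a b c e i : fact4 a b c e 0%R i = nth 0 [:: a; b; c; e] i.
Proof. by rewrite mxE (tnth_nth 0). Qed.

Lemma fact4_eq0 (J : pred 'I_4) a b c e :
  [/\ J (inord 0) -> a = 0, J (inord 1) -> b = 0,
      J (inord 2) -> c = 0 & J (inord 3) -> e = 0] ->
  forall i, J i -> fact4 a b c e 0%R i = 0.
Proof.
by case=> ha hb hc he; apply: forall_ord4; rewrite fact4E inordK.
Qed.

Lemma bettiA_Betti k : 5 <= k -> Betti (gens (6 * k + 1)) (bettiA k).
Proof.
move=> k5.
apply: (@Betti_gens _ (fun i : 'I_4 => (i == 0 :> nat) || (i == 3 :> nat)) _ _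
          (fact4 3 0 0 5) (fact4 0 6 2 0)).
- lia.
- by rewrite fact_hom_gens; congr pt; lia.
- by rewrite fact_hom_gens; congr pt; lia.
- by apply: fact4_eq0; rewrite !inordK.
- by exists (inord 1); rewrite ?fact4E inordK.
move=> a b c e ex ey; case: (fibre_A k5 ex ey) => -[-> ->]; [left|right];
  by apply: fact4_eq0; rewrite !inordK.
Qed.

Lemma bettiB_Betti k : 4 <= k -> Betti (gens (6 * k + 1)) (bettiB k).
Proof.
move=> /subnKC <-; move: (k - 4) => m.
(* With one carry, b + e = k + 1 and b + 2e = 2k - 3, whence b = 5 and
   e = k - 4. *)
apply: (@Betti_gens _ (fun i : 'I_4 => i == 0 :> nat) _ _
          (fact4 (3 * (4 + m) + 4) 0 0 0) (fact4 0 5 (2 * (4 + m) + 2) m)).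
- lia.
- by rewrite fact_hom_gens; congr pt; rewrite -mulnn; lia.
- by rewrite fact_hom_gens; congr pt; rewrite -mulnn; lia.
- by apply: fact4_eq0; rewrite !inordK.
- by exists (inord 1); rewrite ?fact4E inordK.
move=> a b c e ex ey; case: (fibre_B ex ey) => [->|[-> -> ->]]; [right|left];
  by apply: fact4_eq0; rewrite !inordK.
Qed.

(** Division by n: in terms of j = k - i, no subtraction is left, and the two
    remainders show how R_i is factored. *)
Lemma bettiRE i j (k := i + j) : bettiR k i =
  pt ((6 * k + 1) * (3 * k + 3 * j + 2) + (6 * j + 1))
     ((6 * k + 1) * (3 * k + 3 * j + 2) + (18 * j + 3)).
Proof. by rewrite /bettiR /k; congr pt; lia. Qed.

Lemma bettiR_inj k i i' :
  i <= k -> i' <= k -> bettiR k i = bettiR k i' -> i = i'.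
Proof.
move=> ik i'k e.
move: (bettiRE i (k - i)) (bettiRE i' (k - i')); rewrite /= !subnKC // {}e => ->.
case/pt_inj => e _.
have /eqP : (18 * k + 9) * (k - i) = (18 * k + 9) * (k - i') by lia.
by rewrite eqn_pmul2l; lia.
Qed.

Lemma bettiR_Betti i j (k := i + j) : Betti (gens (6 * k + 1)) (bettiR k i).
Proof.
rewrite bettiRE.
apply: (@Betti_gens _ (fun l : 'I_4 => l < 2) _ _
          (fact4 (3 * i + 1) (6 * j + 1) 0 0)
          (fact4 0 0 (2 * i) (6 * j + i + 1))).
- lia.
- by rewrite fact_hom_gens /k; congr pt; lia.
- by rewrite fact_hom_gens /k; congr pt; lia.
- by apply: fact4_eq0; rewrite !inordK.
- by exists (inord 3); rewrite ?fact4E inordK //=; lia.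
move=> a b c e ex ey; case: (fibre_R ex ey) => -[-> ->]; [left|right];
  by apply: fact4_eq0; rewrite !inordK.
Qed.

End Fibres.

Theorem theorem4p2 :
  (forall n k : nat, (5 <= k)%N -> n = (6 * k + 1)%N ->
     [set bettiA k; bettiB k] `|` [set bettiR k i | i in [set i | (i <= k)%N]]
       `<=` Betti (gens n)) /\
  (forall C n0 : nat, exists n : nat,
     [/\ (1 <= n)%N, (n0 <= n)%N & (`I_C #<= Betti (gens n))%card]).
Proof.
have main n k : (5 <= k)%N -> n = (6 * k + 1)%N ->
    [set bettiA k; bettiB k] `|` [set bettiR k i | i in [set i | (i <= k)%N]]
      `<=` Betti (gens n).
  move=> k5 -> _ [[->|->]|[i /= ik <-]].
  - exact: bettiA_Betti.
  - by apply: bettiB_Betti; lia.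
  - by rewrite -(subnKC ik); exact: bettiR_Betti.
split=> // C n0; pose k := (C + n0 + 5)%N.
exists (6 * k + 1)%N; split; [lia|rewrite /k; lia|].
apply: card_le_trans (subset_card_le (main _ k _ erefl)); last by rewrite /k; lia.
have inj : {in `I_C &, injective (bettiR k)}.
  move=> i i' /set_mem iC /set_mem i'C; rewrite /= in iC i'C.
  by apply: bettiR_inj; rewrite /k; lia.
rewrite -(card_le_eql (inj_card_eq inj)); apply: subset_card_le.
by move=> _ [i /= iC <-]; right; exists i => //=; rewrite /k; lia.
Qed.
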